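(* (a) For UFL-out (with non-uniform opening costs), for every constant $\rho\ge1$ and every $M>0$ there is an instance and a set $\mathcal S\subseteq\mathcal C$ that is a local optimum with respect to $\rho$-swaps (no $P\subseteq\mathcal C\setminus\mathcal S$, $Q\subseteq\mathcal S$ with $|P|,|Q|\le\rho$ gives $\mathrm{cost}((\mathcal S\setminus Q)\cup P)<\mathrm{cost}(\mathcal S)$) such that $\mathrm{cost}(\mathcal S)>M\cdot OPT$. (b) For $k$-median-out and for $k$-means-out, for every constant $\rho\ge1$ and every $M>0$ there is an instance in the Euclidean plane and a set $\mathcal S\subseteq\mathcal C$ with $|\mathcal S|\le k$ that is a local optimum with respect to $\rho$-swaps that do not violate the number of clusters (no $P\subseteq\mathcal C\setminus\mathcal S$, $Q\subseteq\mathcal S$ with $|P|,|Q|\le\rho$ and $|(\mathcal S\setminus Q)\cup P|\le k$ gives smaller cost), with at most $z$ outliers in every solution considered, such that $\mathrm{cost}(\mathcal S)>M\cdot OPT$.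
   Context: UFL-out: given finite sets $\mathcal X$ (points) and $\mathcal C$ (centres) in a metric space with distance $\delta$, opening costs $f_c\ge0$ for $c\in\mathcal C$, and an integer $z\ge0$; for $\mathcal S\subseteq\mathcal C$, $\mathrm{cost}(\mathcal S)=\min_{Z\subseteq\mathcal X,|Z|\le z}\sum_{x\in\mathcal X\setminus Z}\delta(x,\mathcal S)+\sum_{c\in\mathcal S}f_c$, and $OPT=\min_{\mathcal S}\mathrm{cost}(\mathcal S)$. $k$-median-out / $k$-means-out: given $\mathcal X,\mathcal C$, integers $k,z$; $\mathrm{cost}(\mathcal S)=\min_{Z\subseteq\mathcal X,|Z|\le z}\sum_{x\in\mathcal X\setminus Z}\delta(x,\mathcal S)$ (respectively with $\delta(x,\mathcal S)^2$), and $OPT$ is the minimum cost over $\mathcal S\subseteq\mathcal C$ with $|\mathcal S|\le k$. Here $\delta(x,\mathcal S)=\min_{c\in\mathcal S}\delta(x,c)$. *)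

(* Defs.v *)
From HB Require Import structures.
From mathcomp Require Import all_boot all_order all_algebra finmap.
From mathcomp Require Import ring lra.
From mathcomp Require Import all_classical all_reals all_analysis.

Set Implicit Arguments.
Unset Strict Implicit.
Unset Printing Implicit Defensive.

Import Order.TTheory GRing.Theory Num.Theory.

Local Open Scope ring_scope.

(* An alias of R * R, whose own canonical (pseudo)metric is the sup one. *)
Definition euclidean_plane (R : realType) : Type := (R * R)%type.

Definition euclidean_dist (R : realType) (x y : euclidean_plane R) : R :=
  Num.sqrt ((x.1 - y.1) ^+ 2 + (x.2 - y.2) ^+ 2).

Section EuclideanPlaneMetric.
Variable R : realType.
Implicit Types x y z : euclidean_plane R.

Lemma euclidean_distxx x : euclidean_dist x x = 0.
Proof. by rewrite /euclidean_dist !subrr expr0n addr0 sqrtr0. Qed.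

Lemma euclidean_dist_positivity x y : euclidean_dist x y = 0 -> x = y.
Proof.
move/eqP; rewrite sqrtr_eq0 => le0.
have: (x.1 - y.1) ^+ 2 + (x.2 - y.2) ^+ 2 == 0.
  by rewrite eq_le le0 addr_ge0 ?sqr_ge0.
rewrite paddr_eq0 ?sqr_ge0// !sqrf_eq0 !subr_eq0 => /andP[/eqP e1 /eqP e2].
by case: x y e1 e2 {le0} => [? ?] [? ?] /= -> ->.
Qed.

Lemma euclidean_dist_sym x y : euclidean_dist x y = euclidean_dist y x.
Proof.
by rewrite /euclidean_dist -(sqrrN (x.1 - y.1)) -(sqrrN (x.2 - y.2)) !opprB.
Qed.

Lemma euclidean_dist_triangle y x z :
  euclidean_dist x z <= euclidean_dist x y + euclidean_dist y z.
Proof.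
rewrite /euclidean_dist.
have -> : x.1 - z.1 = (x.1 - y.1) + (y.1 - z.1) by ring.
have -> : x.2 - z.2 = (x.2 - y.2) + (y.2 - z.2) by ring.
move: (x.1 - y.1) (x.2 - y.2) (y.1 - z.1) (y.2 - z.2) => a b c d.
have p0 : 0 <= a ^+ 2 + b ^+ 2 by rewrite addr_ge0 ?sqr_ge0.
have q0 : 0 <= c ^+ 2 + d ^+ 2 by rewrite addr_ge0 ?sqr_ge0.
have s0 : 0 <= Num.sqrt (a ^+ 2 + b ^+ 2) + Num.sqrt (c ^+ 2 + d ^+ 2).
  by rewrite addr_ge0 ?sqrtr_ge0.
rewrite -(ger0_norm s0) -sqrtr_sqr ler_wsqrtr// (sqrrD (Num.sqrt _)) !sqr_sqrtr// -sqrtrM//.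
have CS : a * c + b * d
    <= Num.sqrt ((a ^+ 2 + b ^+ 2) * (c ^+ 2 + d ^+ 2)).
  apply: (le_trans (ler_norm _)); rewrite -sqrtr_sqr ler_wsqrtr//.
  rewrite -subr_ge0.
  have -> : (a ^+ 2 + b ^+ 2) * (c ^+ 2 + d ^+ 2) - (a * c + b * d) ^+ 2
    = (a * d - b * c) ^+ 2 by ring.
  exact: sqr_ge0.
have -> : (a + c) ^+ 2 + (b + d) ^+ 2
  = a ^+ 2 + b ^+ 2 + (a * c + b * d) *+ 2 + (c ^+ 2 + d ^+ 2) by ring.
by rewrite lerD2r lerD2l lerMn2r.
Qed.

HB.instance Definition _ := Choice.on (euclidean_plane R).
HB.instance Definition _ := isMetric.Build R (euclidean_plane R)
  euclidean_distxx euclidean_dist_positivity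
  euclidean_dist_sym euclidean_dist_triangle.

End EuclideanPlaneMetric.

Local Open Scope fset_scope.
Local Open Scope ereal_scope.

Section ClusteringWithOutliers.
Variables (R : realType) (T : metricType R).
Implicit Types (X C S Z P Q : {fset T}) (x c : T).

(* The minimum over the empty set of centres is +oo. *)
Definition dist_set x S : \bar R := \big[mine/+oo]_(c <- S) (mdist x c)%:E.

(* Z = fset0 is always admissible, so the default value +oo plays no role. *)
Definition outlier_cost (p : nat) X (z : nat) S : \bar R :=
  \big[mine/+oo]_(Z <- fpowerset X | (#|` Z| <= z)%N)
    \sum_(x <- X `\` Z) dist_set x S ^+ p.

Definition ufl_out_cost X (f : T -> R) (z : nat) S : \bar R :=
  outlier_cost 1 X z S + \sum_(c <- S) (f c)%:E.

Definition kmedian_out_cost X (z : nat) S : \bar R := outlier_cost 1 X z S.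

Definition kmeans_out_cost X (z : nat) S : \bar R := outlier_cost 2 X z S.

Definition opt C (feasible : pred {fset T}) (cost : {fset T} -> \bar R)
    : \bar R :=
  \big[mine/+oo]_(S <- fpowerset C | feasible S) cost S.

Definition swap_local_opt (rho : nat) C (feasible : pred {fset T})
    (cost : {fset T} -> \bar R) S : Prop :=
  forall P Q, P `<=` C `\` S -> Q `<=` S ->
    (#|` P| <= rho)%N -> (#|` Q| <= rho)%N ->
    feasible ((S `\` Q) `|` P) ->
    ~ (cost ((S `\` Q) `|` P) < cost S).

Definition at_most_centres (k : nat) : pred {fset T} := fun S => (#|` S| <= k)%N.

End ClusteringWithOutliers.

Arguments at_most_centres {R T} k.

(* Main.v *)
Require Import Defs.
From mathcomp Require Import all_boot all_order all_algebra finmap.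
From mathcomp Require Import all_classical all_reals all_analysis.
From mathcomp Require Import zify.

Set Implicit Arguments.
Unset Strict Implicit.
Unset Printing Implicit Defensive.

Import Order.TTheory GRing.Theory Num.Theory.

(* In every instance the bad solution S discards a set B of exactly z points,
   each at distance at least d from every centre, and serves all other points
   at distance at most d.  Opening a centre near B therefore never pays off by
   itself: an outlier that it frees costs at least d to serve and saves at most
   d.  A large gain needs a resource that is available only after all of B is
   served, hence only after more than rho swaps.
   - UFL-out: the resource is the opening cost H of the only centre of S, which
     can be closed once its m = rho + 1 points A are discarded instead of B.
   - k-median-out and k-means-out: the resource is a spare centre.  A consists
     of m + 1 distant groups of m points, each with a centre in S, and B of m
     distant groups of m + 1 points; trading q groups of A for q groups of B
     frees only q outliers, so that no centre becomes spare before q = m.  The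
     spare centre splits a cluster E which S serves with a single centre, and
     this gain outweighs the cost of serving B by an arbitrary factor. *)

Local Open Scope fset_scope.
Local Open Scope ring_scope.

(** * Sums over finite sets: constant bounds, monotonicity and subadditivity *)

Section FsetSums.
Variables (T : choiceType).
Implicit Types (X Y : {fset T}).

Lemma sum_fsetD (V : nmodType) X Y (F : T -> V) :
  \sum_(x <- X `\` Y) F x = \sum_(x <- X | x \notin Y) F x.
Proof.
rewrite [RHS]big_fset_condE; apply: eq_fbigl => x.
by rewrite !inE andbC.
Qed.

Lemma sum_fset_const (V : nmodType) X (v : V) :
  \sum_(x <- X) v = v *+ #|` X|.
Proof. by rewrite big_const_seq count_predT iter_addr_0. Qed.

Variable R : numDomainType.
Implicit Type f : T -> R.

Lemma sum_fset_le X f (b : R) :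
  (forall x, x \in X -> f x <= b) -> \sum_(x <- X) f x <= b *+ #|` X|.
Proof.
move=> fb; rewrite -sum_fset_const big_seq [leRHS]big_seq.
exact: ler_sum.
Qed.

Lemma sum_fset_ge X f (b : R) :
  (forall x, x \in X -> b <= f x) -> b *+ #|` X| <= \sum_(x <- X) f x.
Proof.
move=> fb; rewrite -sum_fset_const big_seq [leRHS]big_seq.
exact: ler_sum.
Qed.

Lemma sum_fset_sub X Y f : X `<=` Y -> (forall x, 0 <= f x) ->
  \sum_(x <- X) f x <= \sum_(x <- Y) f x.
Proof.
move=> XY f0; rewrite [leRHS](big_fsetID _ (fun x => x \in X))/=.
have -> : [fset x in Y | x \in X] = X.
  apply/fsetP => x; rewrite !inE andbC.
  by have [/(fsubsetP XY)|] := boolP (x \in X).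
by rewrite lerDl; apply: sumr_ge0.
Qed.

Lemma sum_fsetU_le X Y f : (forall x, 0 <= f x) ->
  \sum_(x <- X `|` Y) f x <= \sum_(x <- X) f x + \sum_(x <- Y) f x.
Proof.
move=> f0; rewrite (big_fsetID _ (fun x => x \in X))/=.
apply: lerD; apply: sum_fset_sub => //; apply/fsubsetP => x; rewrite !inE;
  by case: (x \in X); rewrite ?andbF ?andbT.
Qed.

End FsetSums.

(** * Bounds for distances to a set of centres and for costs with outliers *)

Section OutlierCost.
Variables (R : realType) (T : metricType R).
Implicit Types (X B S W Z : {fset T}) (x c : T).

Lemma dist_set_le x c S : c \in S -> (dist_set x S <= (mdist x c)%:E)%E.
Proof. by move=> cS; apply: ge_bigmin_seq. Qed.

(** An empty [S] is covered as well, its distance being [+oo]; solutions without centres thus need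
    no separate case. *)
Lemma le_dist_set x S r :
  (forall c, c \in S -> r <= mdist x c) -> (r%:E <= dist_set x S)%E.
Proof.
move=> rS; rewrite /dist_set big_seq_cond.
by apply: le_bigmin => [|c /andP[cS _]]; rewrite ?leey ?lee_fin ?rS.
Qed.

Lemma dist_set_ge0 x S : (0 <= dist_set x S)%E.
Proof. by apply: le_dist_set => c _; exact: mdist_ge0. Qed.

Lemma dist_set_expe_le p x c S : c \in S ->
  (dist_set x S ^+ p <= (mdist x c ^+ p)%:E)%E.
Proof.
move=> cS; elim: p => [|p IH]; first by rewrite expe0 expr0.
rewrite expeS exprS EFinM; apply: lee_pmul IH; rewrite ?dist_set_le//.
  exact: dist_set_ge0.
by rewrite expe_ge0 ?dist_set_ge0.
Qed.

Lemma le_dist_set_expe p x S r : 0 <= r ->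
  (forall c, c \in S -> r <= mdist x c) ->
  ((r ^+ p)%:E <= dist_set x S ^+ p)%E.
Proof.
move=> r0 rS; elim: p => [|p IH]; first by rewrite expe0 expr0.
rewrite expeS exprS EFinM; apply: lee_pmul IH; rewrite ?lee_fin ?exprn_ge0//.
exact: le_dist_set.
Qed.

(** Real-valued majorants here, and minorants in [le_outlier_cost], move the later arithmetic from
    the extended reals to [R]. *)
Lemma outlier_cost_le p X z S Z (g : T -> R) : Z `<=` X -> (#|` Z| <= z)%N ->
  (forall x, x \in X -> x \notin Z -> (dist_set x S ^+ p <= (g x)%:E)%E) ->
  (outlier_cost p X z S <= (\sum_(x <- X `\` Z) g x)%:E)%E.
Proof.
move=> ZX Zz dg; apply: (@bigmin_inf_seq _ _ _ _ _ Z) => //.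
  by rewrite fpowersetE.
rewrite -sumEFin big_seq [leRHS]big_seq; apply: lee_sum => x.
by rewrite inE => /andP[xZ xX]; exact: dg.
Qed.

Lemma le_outlier_cost p X z S (r : R) (g : T -> R) :
  (forall x, x \in X -> ((g x)%:E <= dist_set x S ^+ p)%E) ->
  (forall Z, Z `<=` X -> (#|` Z| <= z)%N -> r <= \sum_(x <- X `\` Z) g x) ->
  (r%:E <= outlier_cost p X z S)%E.
Proof.
move=> gd rg; rewrite /outlier_cost big_seq_cond.
apply: le_bigmin => [|Z /andP[]]; first exact: leey.
rewrite fpowersetE => ZX Zz.
apply: (@le_trans _ _ (\sum_(x <- X `\` Z) g x)%:E).
  by rewrite lee_fin rg.
rewrite -sumEFin big_seq [leRHS]big_seq; apply: lee_sum => x.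
by rewrite inE => /andP[_ xX]; exact: gd.
Qed.

Lemma outlier_cost_ge0 p X z S : (0 <= outlier_cost p X z S)%E.
Proof.
apply: (@le_outlier_cost _ _ _ _ _ (fun=> 0)) => [x xX|Z _ _].
  by rewrite expe_ge0 ?dist_set_ge0.
by rewrite big1.
Qed.

(* Under a threshold [d] separating [g] on [B] from [g] off [B], discarding
   [B] is the best use of [#|` B|] outliers: compare [g - d] termwise. *)
Lemma outlier_cost_threshold p X z S B (g : T -> R) (d : R) :
  B `<=` X -> (z <= #|` B|)%N -> 0 <= d ->
  (forall x, x \in X -> ((g x)%:E <= dist_set x S ^+ p)%E) ->
  (forall x, x \in B -> d <= g x) ->
  (forall x, x \in X -> x \notin B -> g x <= d) ->
  ((\sum_(x <- X `\` B) g x)%:E <= outlier_cost p X z S)%E.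
Proof.
move=> BX zB d0 gS gB gX; apply: le_outlier_cost gS _ => Z ZX Zz.
have shift Y : \sum_(x <- X `\` Y) g x =
    \sum_(x <- X `\` Y) (g x - d) + d *+ #|` X `\` Y|.
  by rewrite sumrB sum_fset_const subrK.
(* The constant parts compare since [Z] has at most [z] points and [B] at least [z]. *)
rewrite !shift lerD //; last first.
  by rewrite ler_wpMn2l// !cardfsDS// leq_sub2l// (leq_trans Zz).
rewrite !sum_fsetD [leLHS]big_mkcond [leRHS]big_mkcond/= big_seq [leRHS]big_seq.
apply: ler_sum => x xX; have [xB|xB] := boolP (x \in B) => /=.
  by case: ifP => // _; rewrite subr_ge0 gB.
by case: ifP => // _; rewrite subr_le0 gX.
Qed.

(** At most [z] points of [W] can be discarded, and each remaining one pays at least [h]. Truncated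
    subtraction gives the bound 0 when all of [W] may be discarded. *)
Lemma outlier_cost_unserved p X z S W (h : R) : W `<=` X -> 0 <= h ->
  (forall x, x \in W -> (h%:E <= dist_set x S ^+ p)%E) ->
  ((h *+ (#|` W| - z))%:E <= outlier_cost p X z S)%E.
Proof.
move=> WX h0 hW.
apply: (@le_outlier_cost _ _ _ _ _ (fun x => if x \in W then h else 0)).
  move=> x xX; case: ifP => [/hW//|_].
  by rewrite expe_ge0 ?dist_set_ge0.
move=> Z ZX Zz; rewrite -big_mkcond big_fset_condE sum_fset_const ler_wpMn2l//.
have -> : [fset x in X `\` Z | x \in W] = W `\` Z.
  apply/fsetP => x; rewrite !inE andbC andbCA.
  by have [/(fsubsetP WX) ->|] := boolP (x \in W); rewrite ?andbT ?andbF.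
rewrite cardfsD leq_sub2l// (leq_trans _ Zz)//.
by apply: fsubset_leq_card; exact: fsubsetIr.
Qed.

End OutlierCost.

(** * Grids of points in the Euclidean plane *)

Section Blocks.
Variables (R : realType) (G : nat).
Hypothesis G0 : (0 < G)%N.
Implicit Types (x y g : nat) (xs gs : seq nat).

(* Position [x] in group [g]: distinct groups lie on parallel lines at least
   [G] apart. *)
Definition pt x g : euclidean_plane R := (x%:R, (G * g)%:R).

Lemma pt_inj x g y h : pt x g = pt y h -> x = y /\ g = h.
Proof.
case=> /eqP; rewrite eqr_nat => /eqP -> /eqP.
by rewrite eqr_nat eqn_mul2l -leqn0 leqNgt G0 => /eqP ->.
Qed.

Lemma mdist_pt_same x y g : (y <= x)%N ->
  mdist (pt x g) (pt y g) = (x - y)%:R.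
Proof.
move=> yx; rewrite natrB//.
change (euclidean_dist (pt x g) (pt y g) = x%:R - y%:R).
rewrite /euclidean_dist /= subrr expr0n addr0 sqrtr_sqr ger0_norm//.
by rewrite subr_ge0 ler_nat.
Qed.

(** The second coordinates alone differ by a nonzero multiple of [G]. *)
Lemma mdist_pt_far x y g h : g != h -> G%:R <= mdist (pt x g) (pt y h).
Proof.
move=> gh; change (G%:R <= euclidean_dist (pt x g) (pt y h)).
rewrite /euclidean_dist /=.
apply: (@le_trans _ _ `|(G * g)%:R - (G * h)%:R : R|).
  rewrite !natrM -mulrBr normrM normr_nat ler_peMr//.
  wlog lt_gh : g h gh / (g < h)%N.
    move=> H; have [/H|hg|/eqP] := ltngtP g h; last by rewrite (negPf gh).
      exact.
    by rewrite distrC H// eq_sym.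
  rewrite distrC -natrB ?(ltnW lt_gh)// normr_nat ler1n; lia.
by rewrite -sqrtr_sqr ler_wsqrtr// lerDr sqr_ge0.
Qed.

Definition block xs gs : {fset euclidean_plane R} :=
  [fset pt i.1 i.2 | i in [seq (x, g) | x <- xs, g <- gs]].

Lemma in_block xs gs x g : (pt x g \in block xs gs) = (x \in xs) && (g \in gs).
Proof.
apply/imfsetP/andP => [[[y h] /= /allpairsP[[y' h'] /= [yx hg [-> ->]]]]|[xX gG]].
  by case/pt_inj => -> ->.
by exists (x, g) => //=; apply/allpairsP; exists (x, g).
Qed.

Lemma blockP xs gs v :
  reflect (exists x g, [/\ x \in xs, g \in gs & v = pt x g]) (v \in block xs gs).
Proof.
apply: (iffP idP) => [|[x [g [xX gG ->]]]]; last first.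
  by apply/imfsetP; exists (x, g) => //=; apply/allpairsP; exists (x, g).
case/imfsetP => -[x g] /= /allpairsP[[y h] /= [yx hg [-> ->]]] ->.
by exists y, h.
Qed.

Lemma card_block xs gs : uniq xs -> uniq gs ->
  #|` block xs gs| = (size xs * size gs)%N.
Proof.
move=> ux ug; rewrite card_in_imfset/=; last first.
  by move=> [x g] [y h] _ _ /= /pt_inj[-> ->].
rewrite undup_id ?size_allpairs//; apply: allpairs_uniq => //.
by move=> [x g] [y h].
Qed.

End Blocks.

(** * Local optimality and approximation ratio as comparisons of costs *)

Section SwapLocalOpt.
Variables (R : realType) (T : metricType R).
Implicit Types (C S F : {fset T}) (feasible : pred {fset T}).
Implicit Type cost : {fset T} -> \bar R.

(** A swap adds at most [rho] new centres, so each neighbour of [S] is among the sets [F] compared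
    here. *)
Lemma swap_local_optP rho C S feasible cost : S `<=` C ->
  (forall F, F `<=` C -> feasible F -> (#|` F `\` S| <= rho)%N ->
    (cost S <= cost F)%E) ->
  swap_local_opt rho C feasible cost S.
Proof.
move=> SC le_cost P Q PCS QS Prho Qrho feasF; apply/negP; rewrite -leNgt.
apply: le_cost feasF _.
  rewrite fsubUset (fsubset_trans (fsubsetDl _ _) SC).
  exact: fsubset_trans PCS (fsubsetDl _ _).
apply: leq_trans Prho; apply: fsubset_leq_card.
by apply/fsubsetP => x; rewrite !inE; case: (x \in S); rewrite ?andbF.
Qed.

Lemma opt_le C F feasible cost : F `<=` C -> feasible F ->
  (opt C feasible cost <= cost F)%E.
Proof. by move=> FC fF; apply: ge_bigmin_seq => //; rewrite fpowersetE. Qed.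

Lemma opt_ge0 C feasible cost : (forall F, 0 <= cost F)%E ->
  (0 <= opt C feasible cost)%E.
Proof. by move=> cost0; apply: le_bigmin => // ; rewrite leey. Qed.

(** Reduces the ratio to an inequality between natural numbers: [a] bounds the optimum from above,
    [c] the bad cost from below. *)
Lemma mule_opt_lt (M : R) (K a c : nat) (x y : \bar R) :
  (0 <= x -> x <= a%:R%:E -> c%:R%:E <= y -> (0 < M)%R -> (M <= K%:R)%R ->
   (K * a < c)%N -> M%:E * x < y)%E.
Proof.
move=> x0 xa cy M0 MK Kac; apply: lt_le_trans cy.
apply: (@le_lt_trans _ _ (K%:R%:E * a%:R%:E)%E).
  by apply: lee_pmul => //; rewrite lee_fin ?ltW.
by rewrite -EFinM lte_fin -natrM ltr_nat.
Qed.

End SwapLocalOpt.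

(* Plain [lia] is very slow here: it also preprocesses the hypotheses about
   extended reals and the exponentials. *)
Ltac nat_lia :=
  let keep H T :=
    lazymatch T with
    | context [expn] => fail
    | is_true (leq _ _) => revert H
    | is_true (andb _ _) => revert H
    | is_true (orb _ _) => revert H
    | is_true (negb _) => revert H
    | is_true (@eq_op _ _ _) => revert H
    | @eq nat _ _ => revert H
    | @eq bool _ _ => revert H
    end in
  repeat match goal with H : ?T |- _ => keep H T end;
  let k := fresh in pose proof I as k; clear - k; lia.

(** * The bad instance for a bounded number of centres *)

(* Group 0 is E: [N] points near the centre [pt 0 0] and [n] points near
   [pt L 0].  Groups 1, ..., m + 1 form A and groups m + 2, ..., 2 m + 1 form B,
   with a centre [pt 0 g] each.  A point [pt x g] costs [x ^ p] in S. *)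
Section FewCentres.
Variables (R : realType) (p rho m n N L G : nat).

Let z := (m * m.+1)%N.
(** Bounds the cost of [S] once B is discarded; the summands come from A, from the points of E near
    [pt 0 0] and from its far points. *)
Let D := (z * m ^ p + N * N ^ p + n * (L + n) ^ p)%N.

Hypotheses (p0 : (0 < p)%N) (G0 : (0 < G)%N).
Hypotheses (rho_m : (rho < m)%N) (mL : (m <= L)%N).
Hypotheses (nN : (n <= N)%N) (NL : (N <= L)%N) (LG : (L + n + m <= G)%N).
(** By [DG], serving one point from another group costs at least [D]; by [DN], so does serving
    [N - z] near points of E from [pt L 0]. *)
Hypotheses (DG : (D <= G ^ p)%N) (DN : (D <= (N - z) * (L - N) ^ p)%N).

Local Notation pt := (@pt R G).
Local Notation block := (@block R G).

Let A := block (iota 0 m) (iota 1 m.+1).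
Let B := block (iota (L + n) m.+1) (iota m.+2 m).
Let X := block (iota 0 N ++ iota L n) [:: 0] `|` A `|` B.
Let C := pt L 0 |` block [:: 0] (iota 0 (m.+1).*2).
Let S := block [:: 0] (iota 0 m.+2).
(** The comparison solution, with A as outliers: both centres of E and one centre per group of B. *)
Let O := pt L 0 |` block [:: 0] (0 :: iota m.+2 m).

Let inX x g : (pt x g \in X) =
  [|| [&& (x < N) || (L <= x < L + n) & g == 0], (x < m) && (0 < g < m.+2)
    | (L + n <= x < L + n + m.+1) && (m.+2 <= g < m.+2 + m)]%N.
Proof. by rewrite !inE !in_block// mem_cat !mem_iota inE !add0n add1n orbA. Qed.

Let XP v : v \in X -> exists x g, v = pt x g.
Proof.
by rewrite /X !inE -orbA => /or3P[] /blockP[x [g [_ _ ->]]]; exists x, g.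
Qed.

Let inB x g :
  (pt x g \in B) = ((L + n <= x < L + n + m.+1) && (m.+2 <= g < m.+2 + m))%N.
Proof. by rewrite in_block// !mem_iota. Qed.

Let card_B : #|` B| = z.
Proof. by rewrite card_block ?iota_uniq// !size_iota mulnC. Qed.

(** The absolute value keeps it nonnegative on the whole plane, as [sum_fset_sub] requires. *)
Let cost (v : euclidean_plane R) : R := `|v.1| ^+ p.

Let cost_pt x g : cost (pt x g) = (x ^ p)%:R.
Proof. by rewrite /cost normr_nat natrX. Qed.

Let BX : B `<=` X.
Proof. exact: fsubsetUr. Qed.

Let SC : S `<=` C.
Proof.
apply/fsubsetP => _ /blockP[x [g [x0 gS ->]]].
by move: gS; rewrite !inE in_block// x0 !mem_iota => ?; apply/orP; right; nat_lia.
Qed.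

Let OC : O `<=` C.
Proof.
apply/fsubsetP => v; rewrite !inE => /orP[->//|/blockP[x [g [x0 gS ->]]]].
rewrite in_block// x0; apply/orP; right; move: gS.
by rewrite inE !mem_iota => /orP[/eqP ->|]; nat_lia.
Qed.

(** Only a centre of the same group can be closer than [G]: [pt 0 g], at distance [x], or [pt L 0]
    when [g] is 0. *)
Let le_dist_pt (F : {fset euclidean_plane R}) x g r : F `<=` C -> (r <= G)%N ->
  (pt 0 g \in F -> r <= x)%N ->
  (g = 0%N -> pt L 0 \in F -> r%:R <= mdist (pt x g) (pt L 0)) ->
  ((r ^ p)%:R%:E <= dist_set (pt x g) F ^+ p)%E.
Proof.
move=> FC rG rx rL; rewrite natrX; apply: le_dist_set_expe => // c cF.
have rG' : r%:R <= G%:R :> R by rewrite ler_nat.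
have := fsubsetP FC _ cF; rewrite !inE => /orP[/eqP cL|/blockP[y [h []]]].
  rewrite cL in cF *; have [g0|g0] := eqVneq g 0; first exact: rL.
  by apply: le_trans rG' _; exact: mdist_pt_far.
rewrite inE => /eqP -> _ ch; rewrite ch in cF *.
have [gh|gh] := eqVneq g h; last by apply: le_trans rG' _; exact: mdist_pt_far.
by rewrite gh in rx *; rewrite mdist_pt_same// subn0 ler_nat rx.
Qed.

Let cost_S_sum : (outlier_cost p X z S <= (\sum_(v <- X `\` B) cost v)%:E)%E.
Proof.
apply: outlier_cost_le; rewrite ?card_B// => v vX.
have [x [g vE]] := XP vX; rewrite vE in vX *.
rewrite inB => xB; rewrite cost_pt natrX.
have -> : x%:R = mdist (pt x g) (pt 0 g) by rewrite mdist_pt_same// subn0.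
apply: dist_set_expe_le; rewrite in_block// inE mem_iota.
by move: vX; rewrite inX; nat_lia.
Qed.

Let cost_ge0 v : 0 <= cost v.
Proof. by rewrite exprn_ge0. Qed.

Let sum_cost_block xs gs b : uniq xs -> uniq gs ->
  (forall x, x \in xs -> x <= b)%N ->
  \sum_(v <- block xs gs) cost v <= (size xs * size gs * b ^ p)%:R.
Proof.
move=> uxs ugs xsb; rewrite mulnC natrM mulr_natr -(@card_block R G)//.
apply: sum_fset_le => v /blockP[x [g [xxs _ ->]]].
by rewrite cost_pt ler_nat leq_exp2r// xsb.
Qed.

Let sum_cost_le : \sum_(v <- X `\` B) cost v <= D%:R.
Proof.
pose E1 := block (iota 0 N) [:: 0%N]; pose E2 := block (iota L n) [:: 0%N].
apply: (@le_trans _ _ (\sum_(v <- A `|` E1 `|` E2) cost v)).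
  apply: sum_fset_sub => //; apply/fsubsetP => v.
  rewrite 2!inE => /andP[vB /[dup] /XP[x [g vE]]]; rewrite {v}vE in vB *.
  rewrite inX /A !inE !in_block// !inE !mem_iota.
  by move: vB; rewrite inB; nat_lia.
apply: (le_trans (sum_fsetU_le _ _ cost_ge0)); rewrite natrD lerD//; last first.
  apply: le_trans (@sum_cost_block _ _ (L + n) _ _ _) _; rewrite ?iota_uniq//.
    by move=> x; rewrite mem_iota; nat_lia.
  by rewrite size_iota muln1.
apply: (le_trans (sum_fsetU_le _ _ cost_ge0)); rewrite natrD lerD//.
  apply: le_trans (@sum_cost_block _ _ m _ _ _) _; rewrite ?iota_uniq//.
    by move=> x; rewrite mem_iota; nat_lia.
  by rewrite !size_iota.
apply: le_trans (@sum_cost_block _ _ N _ _ _) _; rewrite ?iota_uniq//.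
  by move=> x; rewrite mem_iota; nat_lia.
by rewrite size_iota muln1.
Qed.

Let sum_cost_ge : (n * L ^ p)%:R <= \sum_(v <- X `\` B) cost v.
Proof.
have cardn : #|` block (iota L n) [:: 0%N]| = n.
  by rewrite card_block ?iota_uniq// size_iota muln1.
apply: (@le_trans _ _ (\sum_(v <- block (iota L n) [:: 0%N]) cost v)).
  rewrite mulnC natrM mulr_natr -[X in _ *+ X]cardn; apply: sum_fset_ge => v.
  case/blockP => x [g [+ _ ->]]; rewrite mem_iota cost_pt ler_nat => /andP[Lx _].
  by rewrite leq_exp2r.
apply: sum_fset_sub => //; apply/fsubsetP => v /blockP[x [g []]].
by rewrite mem_iota mem_seq1 => Lx /eqP -> ->; rewrite in_fsetD inB inX; nat_lia.
Qed.

(** Without [pt L 0], each point [pt x g] pays at least [x ^ p], and B consists of the points with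
    [L + n <= x]; hence B is the best choice of outliers. *)
Let sum_cost_le_without F : F `<=` C -> pt L 0 \notin F ->
  ((\sum_(v <- X `\` B) cost v)%:E <= outlier_cost p X z F)%E.
Proof.
move=> FC LF; apply: (@outlier_cost_threshold _ _ _ _ _ _ _ _ ((L + n) ^ p)%:R);
  rewrite ?card_B// => v.
- move=> vX; have [x [g vE]] := XP vX; rewrite vE in vX *.
  rewrite cost_pt; apply: le_dist_pt => //; last by rewrite (negPf LF).
  by move: vX; rewrite inX; nat_lia.
- move=> vB; have [x [g vE]] := XP (fsubsetP BX _ vB); rewrite vE in vB *.
  by rewrite cost_pt ler_nat leq_exp2r//; move: vB; rewrite inB; nat_lia.
- move=> vX; have [x [g vE]] := XP vX; rewrite vE in vX *.
  by rewrite inB cost_pt ler_nat leq_exp2r//; move: vX; rewrite inX; nat_lia.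
Qed.

Let cost_S_le_D : (outlier_cost p X z S <= D%:R%:E)%E.
Proof. by apply: le_trans cost_S_sum _; rewrite lee_fin. Qed.

Let cost_S_le_unserved F W h : W `<=` X -> (D <= (#|` W| - z) * h ^ p)%N ->
  (forall v, v \in W -> ((h ^ p)%:R%:E <= dist_set v F ^+ p)%E) ->
  (outlier_cost p X z S <= outlier_cost p X z F)%E.
Proof.
move=> WX DW hW; apply: le_trans cost_S_le_D _.
apply: le_trans (outlier_cost_unserved z WX _ hW) => //.
by rewrite lee_fin -[leRHS]mulr_natr -natrM ler_nat mulnC.
Qed.

(** The [N] near points of E are then at least [L - N] away from every centre, and only [z] of them
    can be discarded, so that [DN] applies. *)
Let cost_S_le_missing0 F : F `<=` C -> pt 0 0 \notin F ->
  (outlier_cost p X z S <= outlier_cost p X z F)%E.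
Proof.
move=> FC F0; pose W := block (iota 0 N) [:: 0%N].
apply: (@cost_S_le_unserved F W (L - N)).
- apply/fsubsetP => v /blockP[x [g []]].
  by rewrite mem_iota mem_seq1 => xN /eqP -> ->; rewrite inX; nat_lia.
- by rewrite card_block ?iota_uniq// size_iota muln1.
move=> v /blockP[x [g []]]; rewrite mem_iota mem_seq1 => xN /eqP -> ->.
apply: le_dist_pt => //; first nat_lia; first by rewrite (negPf F0).
by move=> _ _; rewrite metric_sym mdist_pt_same ?ler_nat//; nat_lia.
Qed.

(** By counting, more than [z] points of A and B lie in groups without an open centre. One of them
    is served from another group, which already costs [D] by [DG]. *)
Let cost_S_le_with F : F `<=` C -> (#|` F| <= m.+2)%N ->
  (#|` F `\` S| <= rho)%N -> pt 0 0 \in F -> pt L 0 \in F ->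
  (outlier_cost p X z S <= outlier_cost p X z F)%E.
Proof.
move=> FC Fm Frho F0 FL; pose opened g := pt 0 g \in F.
pose a := [seq g <- iota 1 m.+1 | opened g].
pose a' := [seq g <- iota 1 m.+1 | ~~ opened g].
pose b := [seq g <- iota m.+2 m | opened g].
pose b' := [seq g <- iota m.+2 m | ~~ opened g].
have aa' : (size a + size a' = m.+1)%N.
  by rewrite !size_filter (count_predC opened) size_iota.
have bb' : (size b + size b' = m)%N.
  by rewrite !size_filter (count_predC opened) size_iota.
(* The two centres of E leave at most [m] of the [m + 2] places for the groups of A and B. *)
have ab : ((size a + size b).+2 <= m.+2)%N.
  apply: leq_trans Fm; have <- : #|` pt L 0 |` block [:: 0%N] (0%N :: a ++ b)|
    = (size a + size b).+2.
    have L0 : (L == 0%N) = false by nat_lia.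
    rewrite cardfsU1 in_block// mem_seq1 L0 card_block//= ?size_cat.
      by nat_lia.
    rewrite cat_uniq !filter_uniq ?iota_uniq// andbT mem_cat !mem_filter.
    rewrite !mem_iota.
    apply/andP; split; first nat_lia.
    by apply/hasPn => g; rewrite !mem_filter !mem_iota; nat_lia.
  apply: fsubset_leq_card; rewrite fsubUset fsub1set FL/=.
  apply/fsubsetP => v /blockP[x [g []]]; rewrite mem_seq1 => /eqP -> + ->.
  rewrite inE mem_cat !mem_filter => /or3P[/eqP -> //|/andP[]//|/andP[]//].
(* Centres in groups of B are all new, so [rho < m] leaves some group of B without one. *)
have brho : (size b <= rho)%N.
  apply: leq_trans Frho; have <- : #|` block [:: 0%N] b| = size b.
    by rewrite card_block ?filter_uniq ?iota_uniq// mul1n.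
  apply: fsubset_leq_card; apply/fsubsetP => v /blockP[x [g []]].
  rewrite mem_seq1 mem_filter mem_iota => /eqP -> /andP[og gb] ->.
  by rewrite in_fsetD (og : pt 0 g \in F) in_block// mem_seq1 mem_iota; nat_lia.
pose W := block (iota 0 m) a' `|` block (iota (L + n) m.+1) b'.
have cardW : #|` W| = (m * size a' + m.+1 * size b')%N.
  rewrite cardfsU !card_block ?filter_uniq ?iota_uniq// !size_iota.
  rewrite (_ : _ `&` _ = fset0) ?cardfs0 ?subn0//.
  apply/fsetP => v; rewrite !inE; apply/negP => /andP[/blockP[x [g [_ + ->]]]].
  by rewrite in_block// !mem_filter !mem_iota; nat_lia.
have Wz : (z < #|` W|)%N.
  (* Regrouped, the size is [m] times the number of closed groups, which is at least [m + 1], plus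
     [size b'], which is at least 1. *)
  rewrite cardW mulSn addnCA -mulnDr -add1n leq_add// ?leq_mul2l; first nat_lia.
  by apply/orP; right; nat_lia.
apply: (@cost_S_le_unserved F W G).
- apply/fsubsetP => v; rewrite !inE => /orP[] /blockP[x [g [+ + ->]]];
    rewrite mem_filter !mem_iota => xm /andP[_ gm];
    rewrite -!in_fsetU inX; nat_lia.
- by apply: leq_trans DG _; rewrite leq_pmull// subn_gt0.
have far x g : (0 < g)%N -> ~~ opened g ->
    ((G ^ p)%:R%:E <= dist_set (pt x g) F ^+ p)%E.
  move=> g_gt0 ng; apply: le_dist_pt => //.
    by rewrite (negPf (ng : pt 0 g \notin F)).
  by move=> g0; rewrite g0 in g_gt0.
move=> v; rewrite !inE => /orP[] /blockP[x [g [_ + ->]]];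
  by rewrite mem_filter mem_iota /= => /andP[ng gm]; apply: far ng; nat_lia.
Qed.

Let cost_S_le F : F `<=` C -> (#|` F| <= m.+2)%N -> (#|` F `\` S| <= rho)%N ->
  (outlier_cost p X z S <= outlier_cost p X z F)%E.
Proof.
move=> FC Fm Frho; have [FL|] := boolP (pt L 0 \in F); last first.
  by move=> LF; apply: le_trans cost_S_sum _; exact: sum_cost_le_without.
have [F0|] := boolP (pt 0 0 \in F); last exact: cost_S_le_missing0.
exact: cost_S_le_with.
Qed.

Let cost_O_le :
  (outlier_cost p X z O <= (z * (L + n + m) ^ p + (N + n) * N ^ p)%:R%:E)%E.
Proof.
pose E1 := block (iota 0 N) [:: 0%N]; pose E2 := block (iota L n) [:: 0%N].
(* The far points of E lie within [n <= N] of [pt L 0], so [N ^ p] bounds every point of E. *)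
pose bound v : R := (if v \in B then (L + n + m) ^ p else N ^ p)%N%:R.
have cardE : #|` E1 `|` E2| = (N + n)%N.
  rewrite cardfsU !card_block ?iota_uniq// !size_iota !muln1.
  rewrite (_ : _ `&` _ = fset0) ?cardfs0 ?subn0//.
  apply/fsetP => v; rewrite !inE; apply/negP => /andP[/blockP[x [g [+ _ ->]]]].
  by rewrite in_block// !mem_iota; nat_lia.
apply: (@le_trans _ _ (\sum_(v <- X `\` A) bound v)%:E).
  apply: outlier_cost_le.
  - by apply/fsubsetP => v vA; rewrite /X !in_fsetU vA orbT.
  - by rewrite card_block ?iota_uniq// !size_iota.
  move=> v /[dup] /XP[x [g ->]] vX vA; rewrite /bound inB.
  have [/andP[xB gB]|nB] := ifP.
    apply: (le_trans (dist_set_expe_le p _ (_ : pt 0 g \in O))).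
      by rewrite in_fset1U in_block// !inE mem_iota gB !orbT.
    by rewrite mdist_pt_same// subn0 lee_fin -natrX ler_nat leq_exp2r//; nat_lia.
  move: vA; rewrite in_block// !mem_iota => nA.
  have [xN|xN] := ltnP x N.
    apply: (le_trans (dist_set_expe_le p _ (_ : pt 0 g \in O))).
      by rewrite in_fset1U in_block// !inE; move: vX; rewrite inX; nat_lia.
    by rewrite mdist_pt_same// subn0 lee_fin -natrX ler_nat leq_exp2r//; nat_lia.
  have [Lx g0] : (L <= x < L + n)%N /\ g = 0%N by move: vX; rewrite inX; nat_lia.
  rewrite g0; apply: (le_trans (dist_set_expe_le p _ (_ : pt L 0 \in O))).
    by rewrite !inE eqxx.
  by rewrite mdist_pt_same ?lee_fin -?natrX ?ler_nat ?leq_exp2r//; nat_lia.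
rewrite lee_fin natrD.
apply: (@le_trans _ _ (\sum_(v <- B `|` (E1 `|` E2)) bound v)).
  apply: sum_fset_sub => [|v]; last exact: ler0n.
  apply/fsubsetP => v; rewrite in_fsetD => /andP[vA /[dup] /XP[x [g vE]]].
  rewrite {v}vE in vA *; rewrite inX !in_fsetU inB !in_block// !mem_iota.
  by move: vA; rewrite in_block// !mem_iota mem_seq1; nat_lia.
apply: le_trans (sum_fsetU_le _ _ _) _ => [v|]; first exact: ler0n.
rewrite lerD//.
  rewrite mulnC natrM mulr_natr -card_B; apply: sum_fset_le => v vB.
  by rewrite /bound vB.
rewrite mulnC natrM mulr_natr -cardE; apply: sum_fset_le => v.
rewrite /bound !inE => /orP[] /blockP[x [g [_ + ->]]]; rewrite inB mem_seq1;
  by move=> /eqP ->; rewrite andbF.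
Qed.

(** The last hypothesis compares [K] times the cost bound of [O] with what the [n] far points of E
    alone pay in [S]. *)
Lemma outlier_cost_bad_local_opt (M : R) (K : nat) : 0 < M -> M <= K%:R ->
  (K * (z * (L + n + m) ^ p + (N + n) * N ^ p) < n * L ^ p)%N ->
  exists (X C : {fset euclidean_plane R}) (k z : nat)
         (S : {fset euclidean_plane R}),
    [/\ S `<=` C, (#|` S| <= k)%N,
        swap_local_opt rho C (at_most_centres k) (outlier_cost p X z) S &
        (M%:E * opt C (at_most_centres k) (outlier_cost p X z)
           < outlier_cost p X z S)%E].
Proof.
move=> M0 MK Kn; exists X, C, m.+2, z, S; split=> //.
- by rewrite card_block ?iota_uniq// size_iota mul1n.
- by apply: swap_local_optP => // F FC Fm Frho; exact: cost_S_le.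
apply: mule_opt_lt M0 MK Kn.
- by apply: opt_ge0 => F; exact: outlier_cost_ge0.
- apply: le_trans cost_O_le; apply: opt_le => //; rewrite /at_most_centres.
  rewrite cardfsU1 in_block// card_block//= ?size_iota.
    by rewrite mul1n -add1n leq_add2r leq_b1.
  by rewrite mem_iota iota_uniq.
(* [S] itself lacks [pt L 0], so the bound for such sets also estimates its own cost from below. *)
apply: le_trans (sum_cost_le_without SC _); first by rewrite lee_fin.
by rewrite in_block// mem_seq1; nat_lia.
Qed.

End FewCentres.

Lemma bad_instance_sizes (p m K : nat) : (0 < p)%N -> (0 < m)%N ->
  let z := (m * m.+1)%N in
  exists n N L : nat,
    [/\ (m <= L)%N, (n <= N)%N, (N <= L)%N,
        (z * m ^ p + N * N ^ p + n * (L + n) ^ p <= (N - z) * (L - N) ^ p)%N &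
        (K * (z * (L + n + m) ^ p + (N + n) * N ^ p) < n * L ^ p)%N].
Proof.
move=> p0 m0 z; have mz : (m <= z)%N by rewrite leq_pmulr.
(* The factor [2 ^ p] in [n] pays for [L + n + m <= 2 * L]. The factor [4 ^ p] in [N] turns
   [(N * N) ^ p], a lower bound of [(L - N) ^ p], into [(2 * L) ^ p]. *)
clearbody z; pose n := (K * (z * 2 ^ p + 1)).+1.
pose N := (z + n.+1 * 4 ^ p)%N; pose L := (2 * (N * N))%N.
have nN : (n <= N)%N.
  rewrite (leq_trans (leqnSn n))// (leq_trans _ (leq_addl z _))//.
  by rewrite leq_pmulr// expn_gt0.
have zN : (z <= N)%N by rewrite leq_addr.
have NNN : (N <= N * N)%N by rewrite leq_pmulr// (leq_trans _ nN).
have NL : (N + N <= L)%N by rewrite /L mul2n -addnn leq_add.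
have pow_ge (b : nat) : (b <= b ^ p)%N.
  by case: b => // b; rewrite -{1}(expn1 b.+1) leq_pexp2l.
have NNp : (N * N ^ p <= (N * N) ^ p)%N by rewrite expnMn leq_mul2r pow_ge orbT.
have NE : (N - z = n.+1 * 4 ^ p)%N by rewrite /N addKn.
have nE : (K * (z * 2 ^ p + 1) < n)%N by [].
have pow_le b c : (b <= c -> b ^ p <= c ^ p)%N by rewrite leq_exp2r.
exists n, N, L; split.
- exact: leq_trans mz (leq_trans zN (leq_trans NNN (leq_pmull _ _))).
- exact: nN.
- exact: leq_trans (leq_addl _ _) NL.
- have E : ((N - z) * (N * N) ^ p = n.+1 * (2 * L) ^ p)%N.
    by rewrite NE -mulnA -expnMn /L [in RHS](mulnA 2 2).
  apply: (@leq_trans ((N - z) * (N * N) ^ p)); last first.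
    by rewrite leq_mul2l pow_le ?orbT//; clear -NNN NL; rewrite /L in NL *; lia.
  (* Of the [n + 1] copies of [(2 * L) ^ p], [n] cover the far points and one covers the two other
     summands. *)
  rewrite E mulSn leq_add//; last first.
    by rewrite leq_mul2l pow_le ?orbT// mul2n -addnn leq_add2l; clear -nN NL; lia.
  apply: (@leq_trans (2 * (N * N) ^ p)).
    rewrite mul2n -addnn leq_add// (leq_trans _ NNp)// leq_mul// pow_le//.
    exact: leq_trans mz zN.
  rewrite /L (mulnA 2 2) (expnMn (2 * 2)) leq_mul2r.
  by rewrite (leq_trans _ (pow_ge _)) ?orbT.
apply: (@leq_ltn_trans (K * (z * 2 ^ p + 1) * L ^ p)).
  rewrite -mulnA leq_mul2l (mulnDl (z * _)) mul1n leq_add ?orbT//.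
    rewrite -mulnA -expnMn leq_mul2l pow_le ?orbT// mul2n -addnn -addnA leq_add2l.
    by clear -nN mz zN NL; lia.
  apply: (@leq_trans (2 * (N * N) ^ p)).
    rewrite mulnDl mul2n -addnn leq_add// (leq_trans _ NNp)// leq_mul2r nN orbT//.
  by rewrite /L (expnMn 2) leq_mul2r pow_ge orbT.
rewrite ltn_pmul2r// expn_gt0; clear -NL m0 mz zN; lia.
Qed.

(** * The bad instance for non-uniform opening costs *)

Section CostlyCentre.
Variables (R : realType) (rho m H G : nat).

(** [G] bounds the whole cost of [S], so serving a single point from another group is no cheaper
    than [S]. *)
Hypotheses (rho_m : (rho < m)%N) (GE : G = (m * m + H)%N).

Local Notation pt := (@pt R G).
Local Notation block := (@block R G).

Let A := block (iota 0 m) [:: 0%N].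
Let B := block [:: m] (iota 1 m).
Let X := A `|` B.
Let C := block [:: 0%N] (iota 0 m.+1).
Let S := [fset pt 0 0].
Let O := block [:: 0%N] (iota 1 m).

Let opening (c : euclidean_plane R) : R := if c == pt 0 0 then H%:R else 0.

Let mG : (m <= G)%N.
Proof. by rewrite GE (leq_trans _ (leq_addr _ _))// leq_pmulr//; lia. Qed.

Let G0 : (0 < G)%N.
Proof. by apply: leq_trans mG; lia. Qed.

Let opening_ge0 c : 0 <= opening c.
Proof. by rewrite /opening; case: ifP. Qed.

Let openingE (F : {fset euclidean_plane R}) :
  (\sum_(c <- F) (opening c)%:E)%E = (\sum_(c <- F) opening c)%:E.
Proof. by rewrite sumEFin. Qed.

Let opening_S : \sum_(c <- S) opening c = H%:R.
Proof. by rewrite big_seq_fset1 /opening eqxx. Qed.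

Let SC : S `<=` C.
Proof. by rewrite fsub1set in_block// mem_seq1 mem_iota. Qed.

Let OC : O `<=` C.
Proof.
apply/fsubsetP => _ /blockP[x [g [x0 gO ->]]].
by rewrite in_block// x0; move: gO; rewrite !mem_iota; lia.
Qed.

Let cost (v : euclidean_plane R) : R := `|v.1|.

Let cost_pt x g : cost (pt x g) = x%:R.
Proof. by rewrite /cost normr_nat. Qed.

Let inB x g : (pt x g \in B) = (x == m) && (0 < g < m.+1)%N.
Proof. by rewrite in_block// mem_seq1 mem_iota. Qed.

Let inA x g : (pt x g \in A) = (x < m)%N && (g == 0%N).
Proof. by rewrite in_block// mem_seq1 mem_iota. Qed.

Let XP v : v \in X -> exists x g, v = pt x g.
Proof. by rewrite in_fsetU => /orP[] /blockP[x [g [_ _ ->]]]; exists x, g. Qed.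

Let card_A : #|` A| = m.
Proof. by rewrite card_block ?iota_uniq// size_iota muln1. Qed.

Let card_B : #|` B| = m.
Proof. by rewrite card_block ?iota_uniq// size_iota mul1n. Qed.

Let XDB : X `\` B `<=` A.
Proof. by apply/fsubsetP => v; rewrite !inE; case: (v \in B); rewrite ?orbF. Qed.

Let XDA : X `\` A `<=` B.
Proof. by apply/fsubsetP => v; rewrite !inE; case: (v \in A). Qed.

Let le_dist_pt (F : {fset euclidean_plane R}) x g r : F `<=` C -> (r <= G)%N ->
  (pt 0 g \in F -> r <= x)%N -> (r%:R%:E <= dist_set (pt x g) F ^+ 1)%E.
Proof.
move=> FC rG rx; rewrite -[r%:R]expr1; apply: le_dist_set_expe => // c cF.
have /blockP[y [h [+ _ cE]]] := fsubsetP FC _ cF.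
rewrite mem_seq1 => /eqP y0; rewrite cE y0 in cF *.
have [gh|gh] := eqVneq g h.
  by rewrite gh in rx *; rewrite mdist_pt_same// subn0 ler_nat rx.
by apply: (@le_trans _ _ G%:R); rewrite ?ler_nat// mdist_pt_far.
Qed.

Let cost_S_le :
  (ufl_out_cost X opening m S <= (\sum_(v <- X `\` B) cost v + H%:R)%:E)%E.
Proof.
rewrite /ufl_out_cost openingE opening_S EFinD leeD2r//.
apply: outlier_cost_le; rewrite ?card_B ?fsubsetUr// => v vX vB.
have /fsubsetP/(_ v) := XDB; rewrite in_fsetD vB vX => /(_ isT).
case/blockP => x [g [_ + ->]]; rewrite mem_seq1 => /eqP ->.
apply: (le_trans (dist_set_expe_le 1 _ (fset11 (pt 0 0)))).
by rewrite mdist_pt_same// subn0 expr1 cost_pt.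
Qed.

Let cost_S_le_G : (ufl_out_cost X opening m S <= G%:R%:E)%E.
Proof.
apply: le_trans cost_S_le _; rewrite lee_fin GE natrD lerD2r.
apply: (@le_trans _ _ (\sum_(v <- A) cost v)).
  by apply: sum_fset_sub => // v; exact: normr_ge0.
rewrite natrM mulr_natr -{2}card_A; apply: sum_fset_le => v.
case/blockP => x [g [+ _ ->]].
by rewrite mem_iota cost_pt ler_nat; lia.
Qed.

Let cost_S_local F : F `<=` C -> (#|` F `\` S| <= rho)%N ->
  (ufl_out_cost X opening m S <= ufl_out_cost X opening m F)%E.
Proof.
move=> FC Frho; have [F0|F0] := boolP (pt 0 0 \in F).
  apply: le_trans cost_S_le _; rewrite EFinD /ufl_out_cost openingE.
  rewrite leeD//; last first.
    by rewrite lee_fin -opening_S sum_fset_sub// fsub1set.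
  (* Points of A have positions below [m], those of B have position [m]. *)
  apply: (@outlier_cost_threshold _ _ _ _ _ _ _ _ m%:R);
    rewrite ?card_B ?fsubsetUr// => v.
  - move=> vX; have [x [g vE]] := XP vX; rewrite vE in vX *.
    rewrite cost_pt; apply: le_dist_pt => //; apply: leq_trans mG.
    by move: vX; rewrite in_fsetU inA inB; lia.
  - by case/blockP => x [g [+ _ ->]]; rewrite mem_seq1 cost_pt ler_nat => /eqP ->.
  - move=> vX; have [x [g vE]] := XP vX; rewrite vE in vX *.
    by rewrite cost_pt ler_nat; move: vX; rewrite in_fsetU inA inB; lia.
apply: le_trans cost_S_le_G _; rewrite /ufl_out_cost openingE.
(* Opening a centre in each of the groups 1 to [m] would take [m > rho] new centres. *)
have [g gm Fg] : exists2 g, (0 < g < m.+1)%N & pt 0 g \notin F.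
  have [/allP allF|/allPn[g]] := boolP (all (fun g => pt 0 g \in F) (iota 1 m)).
    suff : (m <= rho)%N by lia.
    apply: leq_trans Frho; have <- : #|` O| = m.
      by rewrite card_block ?iota_uniq// size_iota mul1n.
    apply: fsubset_leq_card; apply/fsubsetP => v /blockP[x [g []]].
    rewrite mem_seq1 => /eqP -> gm ->; rewrite in_fsetD allF// andbT inE.
    by apply/eqP => /(pt_inj G0)[_ g0]; rewrite g0 mem_iota in gm.
  by rewrite mem_iota; exists g.
(* A alone would fit into the [m] outliers; one further point forces a service at distance at least
   [G]. *)
pose W := pt m g |` A.
have cardW : #|` W| = m.+1 by rewrite cardfsU1 card_A inA ltnn.
have WX : W `<=` X.
  by rewrite fsubUset fsubsetUl andbT fsub1set in_fsetU inB eqxx gm orbT.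
have unserved : forall v, v \in W -> (G%:R%:E <= dist_set v F ^+ 1)%E.
  move=> v; rewrite in_fset1U => /orP[/eqP ->|/blockP[x [h [_ + ->]]]].
    by apply: le_dist_pt => //; rewrite (negPf Fg).
  by rewrite mem_seq1 => /eqP ->; apply: le_dist_pt => //; rewrite (negPf F0).
have := outlier_cost_unserved m WX (ler0n R G) unserved.
rewrite cardW subSnn => /le_trans; apply.
by rewrite leeDl// lee_fin sumr_ge0.
Qed.

(** With A discarded, the [m] points of B pay [m] each, and the centres of [O] open for free. *)
Let cost_O_le : (ufl_out_cost X opening m O <= (m * m)%:R%:E)%E.
Proof.
rewrite /ufl_out_cost openingE big_seq big1 => [|c]; last first.
  case/blockP => x [g [_ + ->]].
  rewrite mem_iota /opening => gm.
  by case: eqP => // /(pt_inj G0)[_ g0]; rewrite g0 in gm.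
rewrite adde0; apply: (@le_trans _ _ (\sum_(v <- X `\` A) m%:R)%:E).
  apply: outlier_cost_le; rewrite ?card_A ?fsubsetUl// => v vX vA.
  have /fsubsetP/(_ v) := XDA; rewrite in_fsetD vA vX => /(_ isT).
  case/blockP => x [g [+ gm ->]]; rewrite mem_seq1 => /eqP ->.
  apply: (le_trans (dist_set_expe_le 1 _ (_ : pt 0 g \in O))).
    by rewrite in_block// gm.
  by rewrite mdist_pt_same// subn0 expr1.
rewrite lee_fin sum_fset_const natrM mulr_natr ler_wpMn2l//.
by rewrite -[leqRHS]card_B fsubset_leq_card.
Qed.

Lemma ufl_out_bad_local_opt (M : R) (K : nat) : 0 < M -> M <= K%:R ->
  (K * (m * m) < H)%N ->
  exists (T : metricType R) (X C : {fset T}) (f : T -> R) (z : nat),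
    (forall c : T, c \in C -> 0 <= f c) /\
    exists S : {fset T},
      [/\ S `<=` C, swap_local_opt rho C predT (ufl_out_cost X f z) S &
          (M%:E * opt C predT (ufl_out_cost X f z) < ufl_out_cost X f z S)%E].
Proof.
move=> M0 MK KH; exists (euclidean_plane R), X, C, opening, m; split=> //.
exists S; split=> //.
  by apply: swap_local_optP => // F FC _; exact: cost_S_local.
apply: mule_opt_lt M0 MK KH.
- apply: opt_ge0 => F; rewrite adde_ge0 ?outlier_cost_ge0//.
  by rewrite openingE lee_fin sumr_ge0.
- by apply: le_trans cost_O_le; exact: opt_le.
by rewrite /ufl_out_cost openingE opening_S leeDr// outlier_cost_ge0.
Qed.

End CostlyCentre.

(** Treats both objectives at once: [p] is 1 for k-median-out and 2 for k-means-out. *)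
Lemma kclustering_bad_local_opt (R : realType) (p rho : nat) (M : R) :
  (0 < p)%N -> 0 < M ->
  exists (X C : {fset euclidean_plane R}) (k z : nat)
         (S : {fset euclidean_plane R}),
    [/\ S `<=` C, (#|` S| <= k)%N,
        swap_local_opt rho C (at_most_centres k) (outlier_cost p X z) S &
        (M%:E * opt C (at_most_centres k) (outlier_cost p X z)
           < outlier_cost p X z S)%E].
Proof.
move=> p0 M0; pose K := Num.bound M.
have MK : M <= K%:R by rewrite ltW// archi_boundP// ltW.
have [n [N [L [mL nN NL DN Kn]]]] := bad_instance_sizes K p0 (ltn0Sn rho).
set D := (X in (X <= _)%N) in DN.
(* The summand [D] gives [DG], as [G <= G ^ p]; the other one makes the gap between groups exceed
   all positions. *)
pose G := (D + (L + n + rho.+1)).+1.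
apply: (@outlier_cost_bad_local_opt R p rho rho.+1 n N L G) M0 MK Kn => //.
  by rewrite leqW// leq_addl.
apply: leq_trans (_ : G <= _)%N; first by rewrite leqW// leq_addr.
by rewrite -{1}(expn1 G) leq_pexp2l.
Qed.

Theorem theorem4 (R : realType) :
  (forall (rho : nat) (M : R), (1 <= rho)%N -> (0 < M)%R ->
    exists (T : metricType R) (X C : {fset T}) (f : T -> R) (z : nat),
      (forall c : T, c \in C -> (0 <= f c)%R) /\
      exists S : {fset T},
        [/\ (S `<=` C)%fset,
            swap_local_opt rho C predT (ufl_out_cost X f z) S &
            (M%:E * opt C predT (ufl_out_cost X f z)
               < ufl_out_cost X f z S)%E])
  /\
  (forall (rho : nat) (M : R), (1 <= rho)%N -> (0 < M)%R ->
    exists (X C : {fset euclidean_plane R}) (k z : nat)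
           (S : {fset euclidean_plane R}),
      [/\ (S `<=` C)%fset,
          (#|` S| <= k)%N,
          swap_local_opt rho C (at_most_centres k) (kmedian_out_cost X z) S &
          (M%:E * opt C (at_most_centres k) (kmedian_out_cost X z)
             < kmedian_out_cost X z S)%E])
  /\
  (forall (rho : nat) (M : R), (1 <= rho)%N -> (0 < M)%R ->
    exists (X C : {fset euclidean_plane R}) (k z : nat)
           (S : {fset euclidean_plane R}),
      [/\ (S `<=` C)%fset,
          (#|` S| <= k)%N,
          swap_local_opt rho C (at_most_centres k) (kmeans_out_cost X z) S &
          (M%:E * opt C (at_most_centres k) (kmeans_out_cost X z)
             < kmeans_out_cost X z S)%E]).
Proof.
split=> [rho M _ M0|].
  have MK : M <= (Num.bound M)%:R by rewrite ltW// archi_boundP// ltW.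
  (* [H] and [G] stay implicit: the side conditions [K * (m * m) < H] and [G = m * m + H] determine
     suitable values. *)
  by apply: (@ufl_out_bad_local_opt R rho rho.+1 _ _ _ _ M (Num.bound M)).
by split=> rho M _ M0; exact: kclustering_bad_local_opt.
Qed.
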